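(* There exist nonempty two-sided shift spaces $X$ and $Y$ (over finite alphabets) and a factor map $\phi: X \to Y$ such that $h_E(X) = h_F(X) = 0$, but $h_E(Y) > 0$ and $h_F(Y) > 0$.
   Context: A two-sided shift space over a finite alphabet $A$ is a subset $X \subset A^{\mathbb{Z}}$ which is closed (product topology) and invariant under the left shift $\sigma$, $(\sigma x)(n) = x(n+1)$. A factor map from $X$ to $Y$ is a continuous surjective map $\phi: X \to Y$ with $\phi\circ\sigma = \sigma\circ\phi$. The language $L(X)$ is the set of all finite words appearing in points of $X$, and $L_n(X)$ is the set of words of length $n$ in $L(X)$. For $w \in L(X)$, the follower set $F_X(w)$ is the set of all words $u \in L(X)$ such that $wu$ occurs in some point of $X$; the extender set $E_X(w)$ is the set of all pairs $(s,u)$ with $s,u\in L(X)$ such that $swu$ occurs in some point of $X$. Set $F_X(n) = \{F_X(w) : w \in L_n(X)\}$ and $E_X(n) = \{E_X(w) : w \in L_n(X)\}$. The follower entropy is $h_F(X) = \limsup_{n\to\infty}\frac{1}{n}\log|F_X(n)|$ and the extender entropy is $h_E(X) = \lim_{n\to\infty}\frac{1}{n}\log|E_X(n)|$ (this limit exists for every shift space). *)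

(* Defs.v *)
From mathcomp Require Import all_boot all_order all_algebra.
From mathcomp Require Import finmap.
From mathcomp Require Import all_classical all_reals all_analysis.

Set Implicit Arguments.
Unset Strict Implicit.
Unset Printing Implicit Defensive.

Import Order.TTheory GRing.Theory Num.Theory.
Import numFieldNormedType.Exports.

Local Open Scope classical_set_scope.
Local Open Scope ring_scope.

Definition config (A : finType) := {ptws int -> discrete_topology A}.

Definition shift (A : finType) (x : config A) : config A :=
  fun n : int => x (n + 1).

(* The empty set is allowed; "invariant" is read as sigma(X) = X. *)
Definition shift_space (A : finType) (X : set (config A)) : Prop :=
  closed X /\ @shift A @` X = X.

(* A map X -> Y is represented by a total function on configurations, of which
   only the restriction to X matters. *)
Definition factor_map (A B : finType) (X : set (config A)) (Y : set (config B))
    (phi : config A -> config B) : Prop :=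
  [/\ {within X, continuous phi},
      phi @` X = Y
    & forall x, X x -> phi (shift x) = shift (phi x)].

(* The word x(i) x(i+1) ... x(i+n-1). *)
Definition window (A : finType) (x : config A) (i : int) (n : nat) : seq A :=
  mkseq (fun k : nat => x (i + k%:Z)) n.

Definition occurs (A : finType) (w : seq A) (x : config A) : Prop :=
  exists i : int, window x i (size w) = w.

Definition language (A : finType) (X : set (config A)) : set (seq A) :=
  [set w | exists2 x, X x & occurs w x].

Definition language_n (A : finType) (X : set (config A)) (n : nat) :
    set (seq A) :=
  [set w | language X w /\ size w = n].

Definition follower_set (A : finType) (X : set (config A)) (w : seq A) :
    set (seq A) :=
  [set u | language X u /\ exists2 x, X x & occurs (w ++ u) x].

Definition extender_set (A : finType) (X : set (config A)) (w : seq A) :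
    set (seq A * seq A) :=
  [set su | [/\ language X su.1, language X su.2
    & exists2 x, X x & occurs (su.1 ++ w ++ su.2) x]].

Definition follower_sets (A : finType) (X : set (config A)) (n : nat) :
    set (set (seq A)) :=
  [set follower_set X w | w in language_n X n].

Definition extender_sets (A : finType) (X : set (config A)) (n : nat) :
    set (set (seq A * seq A)) :=
  [set extender_set X w | w in language_n X n].

(* [fset_set] is meaningful on finite sets only; the next three lemmas show that
   it is only used on such sets below. *)
Lemma finite_language_n (A : finType) (X : set (config A)) (n : nat) :
  finite_set (language_n X n).
Proof.
apply: (@sub_finite_set _ _ (@tval n A @` [set: n.-tuple A])).
  by move=> w [_ /eqP sw]; exists (Tuple sw).
exact/finite_image/finite_finset.
Qed.

Lemma finite_follower_sets (A : finType) (X : set (config A)) (n : nat) :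
  finite_set (follower_sets X n).
Proof. exact/finite_image/finite_language_n. Qed.

Lemma finite_extender_sets (A : finType) (X : set (config A)) (n : nat) :
  finite_set (extender_sets X n).
Proof. exact/finite_image/finite_language_n. Qed.

Definition follower_rate (R : realType) (A : finType) (X : set (config A))
    (n : nat) : R :=
  n%:R^-1 * ln (#|` fset_set (follower_sets X n)|)%:R.

Definition extender_rate (R : realType) (A : finType) (X : set (config A))
    (n : nat) : R :=
  n%:R^-1 * ln (#|` fset_set (extender_sets X n)|)%:R.

Definition follower_entropy (R : realType) (A : finType) (X : set (config A)) :
    \bar R :=
  limn_esup (fun n => (follower_rate R X n)%:E).

(* Relational form: [has_extender_entropy X h] means that the limit defining the
   extender entropy exists and equals h. *)
Definition has_extender_entropy (R : realType) (A : finType)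
    (X : set (config A)) (h : R) : Prop :=
  extender_rate R X n @[n --> \oo] --> h.

(* Main.v *)
(* A point of Y is a 0-1 sequence carrying at most two anchors; when two anchors
   are at distance d, the block of length d starting at the first anchor has to
   differ somewhere from the block of length d starting at the second one. A point
   of X moreover carries at most two marks and, when there are two anchors at
   distance d, two marks d apart exhibit such a difference. Erasing the marks is a
   factor map from X onto Y.
   Membership in X only depends on the anchors, the marks and the contents of the
   marked letters. A word of length n thus has polynomially many possible extender
   sets in X, and X has entropy 0. In Y, let w_u be the word with content u and an
   anchor on its first letter. For u and v of length n, w_u w_v occurs in Y if and
   only if u <> v. The 2^n words w_u thus have pairwise distinct follower and
   extender sets; since Y has at most 2^n (n+1)^2 words of length n, both entropies
   of Y equal log 2. *)
Require Import Defs.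
From mathcomp Require Import all_boot all_order all_algebra.
From mathcomp Require Import finmap zify ring lra.
From mathcomp Require Import all_classical all_reals all_analysis.

Set Implicit Arguments.
Unset Strict Implicit.
Unset Printing Implicit Defensive.

Import Order.TTheory GRing.Theory Num.Theory.
Import numFieldNormedType.Exports.

Local Open Scope classical_set_scope.
Local Open Scope ring_scope.

(** * Cardinality bounds for finite families of sets *)

Lemma card_fset_set_image_le (S : Type) (U : choiceType) (T : finType)
    (f : S -> U) (D : set S) (r : S -> T -> Prop) :
  finite_set (f @` D) ->
  (forall w, D w -> exists t, r w t) ->
  (forall w w' t, D w -> D w' -> r w t -> r w' t -> f w = f w') ->
  (#|` fset_set (f @` D)| <= #|T|)%N.
Proof.
move=> fin tot det.
have [[w0 Dw0]|D0] := pselect (exists w, D w); last first.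
  rewrite (_ : D = set0) ?image_set0 ?fset_set0//.
  by apply/seteqP; split=> // w Dw; case: D0; exists w.
have /choice[g gP] : forall t, exists u, forall w, D w -> r w t -> f w = u.
  move=> t; have [[w [Dw rwt]]|nr] := pselect (exists w, D w /\ r w t).
    by exists (f w) => w' Dw' rw't; exact: det rwt.
  (* A code that no element of [D] carries gets the default value [f w0]; this is why empty [D] was
     treated apart. *)
  by exists (f w0) => w Dw rwt; case: nr; exists w.
have : (#|` [fset g t | t in T]%fset| <= #|T|)%N.
  by rewrite (leq_trans (leq_imfset_card _ _ _))//= cardE.
apply: leq_trans; apply/fsubset_leq_card/fsubsetP => u.
rewrite in_fset_set// inE => -[w Dw <-].
have [t rwt] := tot _ Dw.
by apply/imfsetP; exists t => //; exact: gP.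
Qed.

Lemma card_fset_set_ge (U : choiceType) (T : finType) (g : T -> U) (D : set U) :
  finite_set D -> injective g -> (forall t, D (g t)) ->
  (#|T| <= #|` fset_set D|)%N.
Proof.
move=> fin ginj gD.
have <- : #|` [fset g t | t in T]%fset| = #|T| by rewrite card_imfset//= cardE.
apply/fsubset_leq_card/fsubsetP => _ /imfsetP[t _ ->].
by rewrite in_fset_set// inE.
Qed.

(** * Topology of configurations *)

Lemma nbhs_letter (A : finType) (x : config A) (i : int) :
  nbhs x [set y : config A | y i = x i].
Proof.
have ni : nbhs (x i) [set x i] := @discrete_set1 (discrete_topology A) (x i).
exact: (@proj_continuous _ (fun=> discrete_topology A) i x _ ni).
Qed.

(** The cylinder of all configurations agreeing with [x] on the finite list [s] is a neighbourhood
    of [x]; if [x] lies outside [P], so does the whole cylinder. *)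
Lemma closed_local (A : finType) (s : seq int) (P : set (config A)) :
  (forall x y, {in s, x =1 y} -> P x -> P y) -> closed P.
Proof.
move=> loc; rewrite -[P]setCK closedC openE => x nPx.
suff : nbhs x [set y : config A | {in s, y =1 x}].
  by apply: filterS => y /= yx Py; apply: nPx; exact: loc Py.
elim: s {loc} => [|i s IHs]; first by apply: filterS filterT.
apply: filterS2 (nbhs_letter x i) IHs => y /= yxi yxs j.
by rewrite inE => /predU1P[->//|/yxs].
Qed.

Lemma cvg_prod_topology (I : choiceType) (T : I -> topologicalType)
    (F : set_system (prod_topology T)) (x : prod_topology T) :
  Filter F -> (forall i, (fun y : prod_topology T => y i) @ F --> x i) -> F --> x.
Proof.
move=> FF Fx; apply/cvg_sup => i V [_ [[W oW <-] Wfx WV]].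
by apply: filterS WV _; apply: (Fx i W); exact: open_nbhs_nbhs.
Qed.

Definition letterwise (A B : finType) (f : A -> B) (x : config A) : config B :=
  fun n => f (x n).

Lemma continuous_letterwise (A B : finType) (f : A -> B) :
  continuous (letterwise f).
Proof.
move=> x; have Fx : Filter (nbhs x) by exact: nbhs_filter.
pose F : set_system (config B) := fmap (letterwise f) (nbhs x).
have FF : Filter F by exact: fmap_filter.
change (F --> letterwise f x).
have cvgF := @cvg_prod_topology int (fun=> discrete_topology B) F _ FF.
apply: cvgF => i V /(@nbhs_singleton (discrete_topology B)) Vx.
apply: filterS (nbhs_letter x i) => y yx.
by move: Vx; rewrite /letterwise/= yx.
Qed.

(** * Exponential growth rate up to a polynomial factor *)

Lemma cvg_log_rate (R : realType) (a : nat) (N : nat -> nat) :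
  (0 < a)%N ->
  (forall n, (0 < n)%N -> (a ^ n <= N n <= a ^ n * (4 * n.+1 ^ 4))%N) ->
  (n%:R^-1 * ln (N n)%:R : R) @[n --> \oo] --> ln (a%:R : R).
Proof.
move=> a0 bnd.
have inv0 : (n%:R^-1 : R) @[n --> \oo] --> 0.
  by apply/gtr0_cvgV0; [near=> n; rewrite ltr0n; near: n; exact: nbhs_infty_gt |
    apply/cvgrnyP].
have sqrt0 : (Num.sqrt (n%:R^-1 : R)) @[n --> \oo] --> 0.
  by rewrite -[X in _ --> X]sqrtr0; exact: (cvg_comp _ _ inv0 (@sqrt_continuous R 0)).
(* For [n > 0], [4 * n.+1 ^ 4 <= 64 * n ^ 4]. The term [8 * Num.sqrt (n%:R^-1)] bounds
   [4 * ln n / n], as [ln n / n] is at most twice the square root of [1 / n]. *)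
apply: (@squeeze_cvgr _ _ _ _ (fun=> ln a%:R)
    (fun n => ln a%:R + (ln 64 * n%:R^-1 + 8 * Num.sqrt (n%:R^-1)))); last 2 first.
- exact: cvg_cst.
- rewrite -[X in _ --> X]addr0; apply: cvgD; first exact: cvg_cst.
  rewrite -[X in _ --> X]addr0; apply: cvgD.
    by rewrite -[X in _ --> X](mulr0 (ln 64)); exact: cvgMr.
  by rewrite -[X in _ --> X](mulr0 8); exact: cvgMr.
near=> n.
have n0 : (0 < n)%N by near: n; exact: nbhs_infty_gt.
have n0R : 0 < n%:R :> R by rewrite ltr0n.
have a0R : 0 < a%:R :> R by rewrite ltr0n.
have /andP[lo hi] := bnd n n0.
have N0 : (0 < N n)%N by rewrite (leq_trans _ lo)// expn_gt0 a0.
have lnan : ln a%:R = n%:R^-1 * ln (a%:R ^+ n) :> R.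
  by rewrite lnXn// -[ln _ *+ n]mulr_natl mulKf// gt_eqF.
rewrite [X in X <= _ <= _]lnan ler_pM2l ?invr_gt0//.
rewrite ler_ln ?posrE ?exprn_gt0 ?ltr0n// -natrX ler_nat lo/=.
have hi' : (N n <= a ^ n * (64 * n ^ 4))%N.
  apply: (leq_trans hi); rewrite leq_pmul2l ?expn_gt0 ?a0//.
  rewrite (_ : 64 = 4 * 2 ^ 4)%N// -mulnA -expnMn leq_mul// leq_exp2r//; lia.
have := hi'; rewrite -(ler_nat R) -ler_ln ?posrE ?ltr0n ?muln_gt0 ?expn_gt0 ?a0 ?n0//.
move=> /(ler_wpM2l (ltW (_ : 0 < n%:R^-1 :> R))) => /(_ ltac:(by rewrite invr_gt0)).
move=> /le_trans; apply.
rewrite natrM natrX natrM [(n ^ 4)%:R]natrX.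
rewrite !lnM ?posrE ?mulr_gt0 ?exprn_gt0 ?ltr0n//.
rewrite !mulrDr -lnan lerD2l [_^-1 * ln 64]mulrC lerD2l.
suff : n%:R^-1 * ln n%:R <= 2 * Num.sqrt n%:R^-1 :> R by lra.
set s := Num.sqrt n%:R^-1.
have s0 : 0 < s by rewrite sqrtr_gt0 invr_gt0.
have sE : n%:R^-1 = s ^+ 2 by rewrite sqr_sqrtr// invr_ge0 ltW.
have -> : n%:R = s^-1 ^+ 2 by rewrite exprVn -sE invrK.
rewrite lnXn ?invr_gt0// exprVn invrK.
(* This is [ln t < t] at [t = s^-1]. *)
have : s * ln s^-1 <= 1.
  by rewrite -ler_pdivlMl// mulr1 ltW// ln_sublinear// invr_gt0.
move=> ls; rewrite -mulr_natr; nra.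
Unshelve. all: by end_near.
Qed.

(** * The two shift spaces *)

Definition at_most_two (h : int -> bool) : Prop :=
  forall i j k, h i -> h j -> h k -> [|| i == j, j == k | i == k].

(** The arguments stand for contents, anchors and marks. Taking [m] constantly true leaves only the
    condition on the blocks, so that one predicate serves both shifts. *)
Definition separated (c h m : int -> bool) : Prop :=
  forall (i : int) (d : nat), (0 < d)%N -> h i -> h (i + d%:Z) ->
    exists2 k : nat, (k < d)%N &
      [&& m (i + k%:Z), m (i + d%:Z + k%:Z) & c (i + k%:Z) != c (i + d%:Z + k%:Z)].

(* A letter of Y is (content, anchor); a letter of X is ((content, anchor), mark). *)
Definition base := (bool * bool)%type.
Definition marked := (base * bool)%type.

Definition pair_shift : set (config base) :=
  [set y | at_most_two (fun n => (y n).2) /\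
           separated (fun n => (y n).1) (fun n => (y n).2) (fun=> true)].

Definition marked_shift : set (config marked) :=
  [set x | [/\ at_most_two (fun n => (x n).1.2), at_most_two (fun n => (x n).2) &
    separated (fun n => (x n).1.1) (fun n => (x n).1.2) (fun n => (x n).2)]].

Lemma at_most_two_translate (h : int -> bool) (a : int) :
  at_most_two h -> at_most_two (fun n => h (n + a)).
Proof.
move=> h2 i j k hi hj hk; have := h2 _ _ _ hi hj hk.
by rewrite !(inj_eq (addIr a)).
Qed.

Lemma separated_translate (c h m : int -> bool) (a : int) :
  separated c h m ->
  separated (fun n => c (n + a)) (fun n => h (n + a)) (fun n => m (n + a)).
Proof.
move=> sep i d d0 hi hj.
have tr (t u : int) : t + u + a = t + a + u by rewrite addrAC.
have [|k kd mc] := sep (i + a) d d0 hi; first by rewrite -tr.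
by exists k => //; rewrite !tr.
Qed.

Lemma shift_space_translate (A : finType) (X : set (config A)) :
  closed X -> (forall (x : config A) (a : int), X x -> X (fun n => x (n + a))) ->
  shift_space X.
Proof.
move=> cX tX; split=> //; apply/seteqP; split=> [_ [x Xx <-]|x Xx].
  exact: tX.
exists (fun n => x (n - 1)); first exact: tX.
by apply/funext => n; rewrite /Defs.shift/= addrK.
Qed.

Lemma closed_at_most_two (A : finType) (h : A -> bool) :
  closed [set x : config A | at_most_two (fun n => h (x n))].
Proof.
rewrite (_ : mkset _ = \bigcap_(t in [set: int * int * int])
  [set x : config A | h (x t.1.1) -> h (x t.1.2) -> h (x t.2) ->
    [|| t.1.1 == t.1.2, t.1.2 == t.2 | t.1.1 == t.2]]); last first.
  apply/seteqP; split=> [x x2 [[i j] k] _|x x2 i j k]; first exact: x2.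
  exact: (x2 (i, j, k)).
apply: closed_bigI => -[[i j] k] _ /=.
apply: (@closed_local _ [:: i; j; k]) => x y xy /=.
by rewrite -!xy// !inE eqxx ?orbT.
Qed.

(** For fixed [i] and [d] the witness satisfies [k < d], so only the [2d] letters from [i] on are
    inspected. The set is thus an intersection of conditions on finitely many coordinates. *)
Lemma closed_separated (A : finType) (c h m : A -> bool) :
  closed [set x : config A |
    separated (fun n => c (x n)) (fun n => h (x n)) (fun n => m (x n))].
Proof.
pose P (t : int * nat) (x : config A) := (0 < t.2)%N -> h (x t.1) ->
  h (x (t.1 + t.2%:Z)) -> exists2 k : nat, (k < t.2)%N &
    [&& m (x (t.1 + k%:Z)), m (x (t.1 + t.2%:Z + k%:Z)) &
        c (x (t.1 + k%:Z)) != c (x (t.1 + t.2%:Z + k%:Z))].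
rewrite (_ : mkset _ = \bigcap_(t in [set: int * nat]) [set x | P t x]); last first.
  apply/seteqP; split=> [x sx [i d] _|x sx i d]; first exact: sx.
  exact: (sx (i, d)).
apply: closed_bigI => -[i d] _ /=.
apply: (@closed_local _ [seq i + k%:Z | k <- iota 0 d.*2]) => x y xy.
have xyE (k : nat) : (k < d.*2)%N -> x (i + k%:Z) = y (i + k%:Z).
  by move=> kd; apply: xy; apply/mapP; exists k => //; rewrite mem_iota.
rewrite /P/= => Px d0.
have xy0 : x i = y i by rewrite -[i]addr0; apply: (xyE 0%N); lia.
rewrite -xy0 -xyE; last lia.
move=> hi hj; have [k kd mc] := Px d0 hi hj; exists k => //.
by rewrite -addrA -PoszD -!xyE ?PoszD ?addrA//; lia.
Qed.

Lemma shift_space_pair : shift_space pair_shift.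
Proof.
apply: shift_space_translate => [|y a [h2 sep]].
  exact: (closedI (@closed_at_most_two base snd)
    (@closed_separated base fst snd (fun=> true))).
split; first exact: (@at_most_two_translate _ a h2).
exact: (@separated_translate _ _ _ a sep).
Qed.

Lemma shift_space_marked : shift_space marked_shift.
Proof.
apply: shift_space_translate => [|y a [h2 m2 sep]].
  rewrite (_ : marked_shift =
      [set x | at_most_two (fun n => (x n).1.2)] `&`
    ([set x | at_most_two (fun n => (x n).2)] `&`
     [set x | separated (fun n => (x n).1.1) (fun n => (x n).1.2)
                        (fun n => (x n).2)])).
    apply: closedI; first exact: (@closed_at_most_two marked (snd \o fst)).
    exact: (closedI (@closed_at_most_two marked snd)
      (@closed_separated marked (fst \o fst) (snd \o fst) snd)).
  by apply/seteqP; split=> x; [move=> []|move=> [? []]].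
split; [exact: (@at_most_two_translate _ a h2)|
  exact: (@at_most_two_translate _ a m2)|].
exact: (@separated_translate _ _ _ a sep).
Qed.

Lemma marked_shift0 : marked_shift (fun=> (false, false, false)).
Proof. by split. Qed.

(** * Erasing the marks *)

Lemma factor_map_unmark : factor_map marked_shift pair_shift (letterwise fst).
Proof.
split=> //.
  exact/continuous_subspaceT/continuous_letterwise.
apply/seteqP; split=> [_ [x [h2 m2 sep] <-]|y [h2 sep]].
  split=> // i d d0 hi hj; have [k kd /and3P[_ _ ck]] := sep i d d0 hi hj.
  by exists k.
have [[i [d [d0 hi hj]]]|none] :=
    pselect (exists i (d : nat), [/\ (0 < d)%N, (y i).2 & (y (i + d%:Z)).2]);
  last first.
  (* Without two distinct anchors there is nothing to exhibit, and a lift with no marks works. *)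
  exists (fun n => (y n, false)); last by apply/funext.
  by split=> // i d d0 hi hj; case: none; exists i, d.
have [k kd ck] := sep i d d0 hi hj.
(* The marks go to the same offset [k] in both blocks, at a place where these differ. *)
exists (fun n => (y n, (n == i + k%:Z) || (n == i + d%:Z + k%:Z))); last exact/funext.
split=> //.
  by move=> n1 n2 n3 /= /orP[] /eqP-> /orP[] /eqP-> /orP[] /eqP->; rewrite eqxx ?orbT.
move=> i' d' d'0 hi' hj'.
(* As there are at most two anchors and both distances are positive, the two pairs of anchors
   coincide. *)
have [ii' dd'] : i' = i /\ d' = d.
  have := h2 _ _ _ hi hj hi'; have := h2 _ _ _ hi hj hj'.
  have := h2 _ _ _ hi hi' hj'; have := h2 _ _ _ hj hi' hj'; lia.
rewrite {}ii' {}dd'; exists k => //=.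
by rewrite !eqxx orbT; case/and3P: ck.
Qed.

(** * Coding words and counting follower and extender sets *)

Lemma nth_window (A : finType) (a : A) (x : config A) (i : int) (n k : nat) :
  (k < n)%N -> nth a (window x i n) k = x (i + k%:Z).
Proof. by move=> kn; rewrite nth_mkseq. Qed.

Lemma language_code (A C : finType) (X : set (config A)) (code : A -> C) :
  (forall x y : config A, (forall n, code (x n) = code (y n)) -> X x -> X y) ->
  forall v v', map code v = map code v' -> language X v -> language X v'.
Proof.
move=> Xcode v v' vv' [x Xx [i xv]].
have sv : size v = size v' by rewrite -(size_map code v) vv' size_map.
(* [v'] is pasted into [x] over the occurrence of [v] at [i], which changes no code. *)
pose y : config A := fun n : int =>
  if (i <= n) && (`|n - i|%N < size v')%N then nth (x n) v' `|n - i|%N else x n.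
exists y.
  apply: Xcode Xx => n; rewrite /y; case: ifPn => // /andP[le_in lt_n].
  have -> : x n = nth (x n) v `|n - i|%N.
    rewrite -[in RHS]xv nth_window ?sv//; congr x; lia.
  by rewrite -!(nth_map _ (code (x n))) ?sv// vv'.
exists i; apply: (@eq_from_nth _ (x 0)) => [|k]; rewrite size_mkseq// => kv.
rewrite nth_window// /y ifT; last by apply/andP; split; lia.
have -> : `|(i + k%:Z - i)%R|%N = k by lia.
exact: set_nth_default.
Qed.

Lemma language_cat (A : finType) (X : set (config A)) (v w : seq A) :
  language X (v ++ w) -> language X v /\ language X w.
Proof.
move=> [x Xx [i xvw]].
split; exists x => //; [exists i|exists (i + (size v)%:Z)].
  apply: (@eq_from_nth _ (x 0)) => [|k]; rewrite size_mkseq// => kv.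
  have := congr1 (fun s => nth (x 0) s k) xvw.
  by rewrite nth_cat kv !nth_window// size_cat ltn_addr.
apply: (@eq_from_nth _ (x 0)) => [|k]; rewrite size_mkseq// => kw.
have := congr1 (fun s => nth (x 0) s (size v + k)%N) xvw.
rewrite nth_cat ltnNge leq_addr/= addKn !nth_window// ?size_cat ?ltn_add2l//.
by rewrite PoszD addrA.
Qed.

Section word_counts.
Variables (A : finType) (X : set (config A)).

Definition nfollower (n : nat) : nat := #|` fset_set (follower_sets X n)|.
Definition nextender (n : nat) : nat := #|` fset_set (extender_sets X n)|.

(** Words with equal codes can replace each other in any context, so they have the same follower set
    and the same extender set; both counts are at most the number of codes. *)
Lemma count_le (C T : finType) (code : A -> C) (W : T -> seq C) (n : nat) :
  (forall x y : config A, (forall n, code (x n) = code (y n)) -> X x -> X y) ->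
  (forall x i, X x -> exists t, map code (window x i n) = W t) ->
  (nfollower n <= #|T|)%N /\ (nextender n <= #|T|)%N.
Proof.
move=> Xcode cover.
have Lcode := language_code Xcode.
have tot w : language_n X n w -> exists t, map code w = W t.
  by move=> [[x Xx [i xw]] wn]; rewrite -xw wn; exact: cover.
split; apply: (card_fset_set_image_le (r := fun w t => map code w = W t)) => //.
- exact: finite_follower_sets.
- move=> w w' t _ _ wt w't; have ww' : map code w = map code w' by rewrite wt.
  apply/seteqP; split=> u [Lu Lwu]; split=> //; apply: Lcode Lwu;
    by rewrite !map_cat ww'.
- exact: finite_extender_sets.
- move=> w w' t _ _ wt w't; have ww' : map code w = map code w' by rewrite wt.
  apply/seteqP; split=> -[s u] [Ls Lu Lswu]; split=> //; apply: Lcode Lswu;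
    by rewrite !map_cat ww'.
Qed.

(** [W t'] follows [W t] exactly when [t != t']. If [W t] and [W t'] had equal follower sets for
    [t != t'], then [W t'] would follow itself. The context [([::], W t')] does the same for
    extender sets. *)
Lemma count_ge (T : finType) (W : T -> seq A) (n : nat) :
  (forall t, size (W t) = n) ->
  (forall t t', language X (W t ++ W t') <-> t != t') ->
  (forall t, language X (W t)) ->
  (#|T| <= nfollower n)%N /\ (#|T| <= nextender n)%N.
Proof.
move=> sW LWW LW.
have L0 (t : T) : language X ([::] : seq A).
  by have [] := @language_cat _ X [::] (W t) (LW t).
split.
  apply: (card_fset_set_ge (g := follower_set X \o W)).
  - exact: finite_follower_sets.
  - move=> t t' /= tt'; apply/eqP/negP => /negP /LWW Ltt'.
    have : follower_set X (W t) (W t') by split.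
    by rewrite tt' => -[_ /LWW]; rewrite eqxx.
  - by move=> t; exists (W t).
apply: (card_fset_set_ge (g := extender_set X \o W)).
- exact: finite_extender_sets.
- move=> t t' /= tt'; apply/eqP/negP => /negP /LWW Ltt'.
  have : extender_set X (W t) ([::], W t') by split; [exact: (L0 t)|exact: LW|].
  by rewrite tt' => -[_ _ /LWW]; rewrite eqxx.
- by move=> t; exists (W t).
Qed.

End word_counts.

(** * Polynomial bounds for the marked shift *)

(** The value [n] in ['I_n.+1] equals no [k < n]; it fills the slots of positions missing from the
    window. *)
Lemma at_most_two_window (h : int -> bool) (i : int) (n : nat) :
  at_most_two h -> exists a b : 'I_n.+1,
    forall k, (k < n)%N -> h (i + k%:Z) = (k == a) || (k == b).
Proof.
move=> h2.
have [a ha|none] := pickP [pred a : 'I_n | h (i + (a : nat)%:Z)]; last first.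
  exists ord_max, ord_max => k kn; rewrite orbb (ltn_eqF kn).
  exact: (none (Ordinal kn)).
have [b /= /andP[ba hb]|none] :=
    pickP [pred b : 'I_n | (b != a) && h (i + (b : nat)%:Z)].
  exists (widen_ord (leqnSn n) a), (widen_ord (leqnSn n) b) => k kn /=.
  apply/idP/orP => [hk|[] /eqP-> //]; move: ba; rewrite -val_eqE/= => ba.
  have := h2 _ _ _ ha hb hk; lia.
exists (widen_ord (leqnSn n) a), ord_max => k kn /=.
rewrite (ltn_eqF kn) orbF; apply/idP/eqP => [hk|-> //].
by have := none (Ordinal kn); rewrite /= hk andbT -val_eqE/= => /negbFE/eqP.
Qed.

Lemma marked_code (n : nat) (x : config marked) (i : int) :
  marked_shift x ->
  exists t : 'I_n.+1 * 'I_n.+1 * ('I_n.+1 * 'I_n.+1) * (bool * bool),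
    map (fun a : marked => (a.1.1 && a.2, a.1.2, a.2)) (window x i n) =
    mkseq (fun k => ((k == t.1.2.1) && t.2.1 || (k == t.1.2.2) && t.2.2,
      (k == t.1.1.1) || (k == t.1.1.2), (k == t.1.2.1) || (k == t.1.2.2))) n.
Proof.
move=> [h2 m2 _].
have [a [b hab]] := at_most_two_window i n h2.
have [p [q mpq]] := at_most_two_window i n m2.
(* If [p] or [q] is [n], the bit is read just outside the window, where no [k < n] uses it. If
   [p = q], both bits are the same letter's content. *)
exists ((a, b), (p, q), ((x (i + (p : nat)%:Z)).1.1, (x (i + (q : nat)%:Z)).1.1)).
rewrite -map_comp; apply/eq_in_map => k; rewrite mem_iota => /= kn.
rewrite hab// mpq//.
by have [kp|_] := eqVneq k p; have [kq|_] := eqVneq k q;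
  rewrite /= -?kp -?kq ?orbF ?orbb ?andbT ?andbF.
Qed.

(** [separated] compares contents at marked letters only, so the code may forget the content of
    every unmarked letter. *)
Lemma marked_shift_code (x y : config marked) :
  (forall n, ((x n).1.1 && (x n).2, (x n).1.2, (x n).2) =
             ((y n).1.1 && (y n).2, (y n).1.2, (y n).2)) ->
  marked_shift x -> marked_shift y.
Proof.
move=> xy [h2 m2 sep].
have hE n : (x n).1.2 = (y n).1.2 by case: (xy n).
have mE n : (x n).2 = (y n).2 by case: (xy n).
have cE n : (x n).2 -> (x n).1.1 = (y n).1.1.
  by move=> xm; case: (xy n); rewrite -mE xm !andbT.
split.
- by move=> i j k; rewrite -!hE; exact: h2.
- by move=> i j k; rewrite -!mE; exact: m2.
move=> i d d0; rewrite -!hE => hi hj.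
have [k kd /and3P[m1 m1' ck]] := sep i d d0 hi hj.
by exists k => //; rewrite -!mE -!cE// m1 m1'.
Qed.

(* Two anchor positions, two mark positions ([n] standing for "outside the
   window") and the two marked contents make up at most [4 * n.+1 ^ 4] codes. *)
Lemma marked_counts (n : nat) :
  (1 ^ n <= nfollower marked_shift n <= 1 ^ n * (4 * n.+1 ^ 4))%N /\
  (1 ^ n <= nextender marked_shift n <= 1 ^ n * (4 * n.+1 ^ 4))%N.
Proof.
have [] := count_le marked_shift_code (@marked_code n).
rewrite !card_prod !card_ord card_bool exp1n mul1n => hF hE.
have -> : (4 * n.+1 ^ 4 = n.+1 * n.+1 * (n.+1 * n.+1) * (2 * 2))%N by ring.
rewrite hF hE !andbT.
pose w := window ((fun=> (false, false, false)) : config marked) 0 n.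
have Lw : language_n marked_shift n w.
  split; last by rewrite size_mkseq.
  exists (fun=> (false, false, false)); first exact: marked_shift0.
  by exists 0; rewrite size_mkseq.
rewrite !cardfs_gt0; split; apply/fset0Pn.
  exists (follower_set marked_shift w).
  by rewrite in_fset_set ?inE; [exists w|exact: finite_follower_sets].
exists (extender_set marked_shift w).
by rewrite in_fset_set ?inE; [exists w|exact: finite_extender_sets].
Qed.

(** * Exponential counts for the pair shift *)

Definition anchored_word (n : nat) (u : n.-tuple bool) : seq base :=
  mkseq (fun k => (nth false u k, k == 0%N)) n.

(** In any occurrence the two initial anchors are [n] apart, so the blocks that must differ are
    exactly [u] and [v]. Conversely, the word is placed at 0 on a background of [(false, false)]. *)
Lemma language_anchored_words (n : nat) (u v : n.-tuple bool) : (0 < n)%N ->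
  language pair_shift (anchored_word u ++ anchored_word v) <-> u != v.
Proof.
move=> n0; split=> [[y [h2 sep] [i yuv]]|uv].
  have yE (k : nat) : (k < n)%N ->
      y (i + k%:Z) = (nth false u k, k == 0%N) /\
      y (i + n%:Z + k%:Z) = (nth false v k, k == 0%N).
    move=> kn; have sz : size (anchored_word u ++ anchored_word v) = (n + n)%N.
      by rewrite size_cat !size_mkseq.
    rewrite sz in yuv; rewrite -addrA -PoszD.
    rewrite -!(@nth_window _ (false, false) y i (n + n)) ?ltn_add2l ?ltn_addr// yuv.
    rewrite !nth_cat size_mkseq kn ltnNge leq_addr/= addKn.
    by rewrite /anchored_word !nth_mkseq.

  have [] := yE 0%N n0; rewrite !addr0 => hi hj.
  have [||k kn] := sep i n n0; rewrite ?hi ?hj//=.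
  have [-> ->] /= := yE k kn.
  by apply: contraNneq => ->.
pose y : config base := fun m : int =>
  if m is Posz k then
    if (k < n)%N then (nth false u k, k == 0%N)
    else if (k < n + n)%N then (nth false v (k - n), k - n == 0)%N
    else (false, false)
  else (false, false).
have hE m : (y m).2 -> m = 0 \/ m = n%:Z.
  rewrite /y; case: m => // k.
  by case: ifPn => /= ?; [|case: ifPn => //= ?] => /eqP; lia.
exists y.
  split=> [i j k /hE + /hE + /hE|i d d0 /hE hi /hE hj]; first lia.
  (* The anchors of [y] lie at 0 and [n], so this is the only pair at positive distance. *)
  have [{hi}-> {hj d0}->] : i = 0 /\ d = n by lia.
  have [k unvk] : exists k : 'I_n, tnth u k != tnth v k.
    apply/existsP; apply: contra_neqT uv; rewrite negb_exists => /forallP uv.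
    by apply: eq_from_tnth => k; have := uv k; rewrite negbK => /eqP.
  exists (k : nat); first exact: ltn_ord.
  rewrite !add0r -PoszD /y/= ltn_ord ltnNge leq_addr/=.
  by rewrite ltn_add2l ltn_ord addKn /= -!tnth_nth.
exists 0; apply: (@eq_from_nth _ (false, false)) => [|k]; rewrite size_mkseq// => kn.
rewrite nth_window// add0r nth_cat; move: kn; rewrite size_cat !size_mkseq => kn /=.
by case: ltnP => kn'; rewrite ?kn nth_mkseq//; lia.
Qed.

(** Since [n > 0], [u] differs from its bitwise complement, so its word can be followed by the word
    of that complement. *)
Lemma language_anchored_word (n : nat) (u : n.-tuple bool) : (0 < n)%N ->
  language pair_shift (anchored_word u).
Proof.
move=> n0; have : u != [tuple of map negb u].
  apply/eqP => /(congr1 (fun t => tnth t (Ordinal n0))).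
  by rewrite tnth_map; case: (tnth u _).
by move=> /(language_anchored_words _ _ n0)/language_cat[].
Qed.

(** Here the code is the identity: counting all words is enough for the upper bound. *)
Lemma pair_code (n : nat) (y : config base) (i : int) :
  pair_shift y ->
  exists t : n.-tuple bool * ('I_n.+1 * 'I_n.+1),
    map id (window y i n) =
    mkseq (fun k => (nth false t.1 k, (k == t.2.1) || (k == t.2.2))) n.
Proof.
move=> [h2 _]; have [a [b hab]] := at_most_two_window i n h2.
exists ([tuple (y (i + (k : nat)%:Z)).1 | k < n], (a, b)).
rewrite map_id; apply/eq_in_map => k; rewrite mem_iota => /= kn.
have := tnth_mktuple (fun k : 'I_n => (y (i + (k : nat)%:Z)).1) (Ordinal kn).
by rewrite (tnth_nth false) -hab// => ->; case: (y _).
Qed.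

Lemma pair_counts (n : nat) : (0 < n)%N ->
  (2 ^ n <= nfollower pair_shift n <= 2 ^ n * (4 * n.+1 ^ 4))%N /\
  (2 ^ n <= nextender pair_shift n <= 2 ^ n * (4 * n.+1 ^ 4))%N.
Proof.
move=> n0.
have codeK (x y : config base) : (forall n, x n = y n) -> pair_shift x -> pair_shift y.
  by move=> /funext ->.
have [] := count_le (code := id) codeK (@pair_code n).
have [] := @count_ge _ pair_shift _ (@anchored_word n) n.
- by move=> t; rewrite size_mkseq.
- by move=> t t'; exact: language_anchored_words.
- by move=> t; exact: language_anchored_word.
rewrite !card_prod card_tuple !card_ord card_bool => -> -> hF hE /=.
(* The factor for the two anchor positions is relaxed to the polynomial of [cvg_log_rate]. *)
suff le : (n.+1 * n.+1 <= 4 * n.+1 ^ 4)%N.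
  by split; [apply: leq_trans hF _|apply: leq_trans hE _]; rewrite leq_pmul2l ?expn_gt0.
rewrite mulnn; apply: leq_trans (leq_pexp2l (ltn0Sn n) (isT : (2 <= 4)%N)) _.
exact: leq_pmull.
Qed.

(** * The entropies of both shifts *)

Theorem theorem3p7 (R : realType) :
  exists (A B : finType) (X : set (config A)) (Y : set (config B))
         (phi : config A -> config B),
    [/\ shift_space X /\ X !=set0,
        shift_space Y /\ Y !=set0,
        factor_map X Y phi,
        has_extender_entropy X (0 : R) /\ follower_entropy R X = 0%E
      & (exists2 h : R, has_extender_entropy Y h & 0 < h) /\
        (0 < follower_entropy R Y)%E].
Proof.
exists marked, base, marked_shift, pair_shift, (letterwise fst).
have ln2 : 0 < ln (2%:R : R) by rewrite ln_gt0// ltr1n.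
have esup (A : finType) (X : set (config A)) (h : R) :
    follower_rate R X n @[n --> \oo] --> h -> follower_entropy R X = h%:E.
  move=> Xh; apply: (cvg_limn_einf_sup _).2.
  by apply: cvg_comp Xh _; exact: cvg_id.
have mF n : (0 < n)%N -> _ := fun=> (marked_counts n).1.
have mE n : (0 < n)%N -> _ := fun=> (marked_counts n).2.
split.
- split; first exact: shift_space_marked.
  by exists (fun=> (false, false, false)); exact: marked_shift0.
- by split; [exact: shift_space_pair|exists (fun=> (false, false))].
- exact: factor_map_unmark.
- split.
    by have := @cvg_log_rate R 1 _ isT mE; rewrite ln1.
  by apply: esup; have := @cvg_log_rate R 1 _ isT mF; rewrite ln1.
have pF n : (0 < n)%N -> _ := fun n0 => (pair_counts n0).1.
have pE n : (0 < n)%N -> _ := fun n0 => (pair_counts n0).2.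
split; first by exists (ln 2%:R) => //; exact: (@cvg_log_rate R 2 _ isT pE).
by rewrite (esup _ _ (ln 2%:R)) ?lte_fin//; exact: (@cvg_log_rate R 2 _ isT pF).
Qed.
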